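(* Let $d\ge1$, $n\ge2$, $q\in(0,1)$, and consider the continuous-time multi-hop model on the torus $\mathcal{T}_n$ described in the context, with exogenous arrival rate $\lambda q$ at every node. Assume that $\lambda<\frac{1}{2d+1}$. Let $X^{(n)}$ denote the stationary number of messages in queue $0$. Then $$\mathbb{E}(X^{(n)})\ \le\ \frac{\lambda}{q\left(\frac{1}{2d+1}-\lambda\right)}.$$
   Context: $\mathcal{T}_n=\{i\in\mathbb{Z}^d: i_k\in\{-n,\dots,n-1\}\ \forall k\}$ with coordinates taken modulo $2n$; nodes are adjacent if they are connected by one edge of the lattice (wrapped around), so $\mathcal{T}_n$ is a $2d$-regular graph. $\mathcal{N}_i$ is the set consisting of $i$ and its $2d$ adjacent nodes. The service rates are $\psi_i(\bar x)=x_i/\sum_{j\in\mathcal{N}_i}x_j$, with $0/0:=0$. The state $\bar X(t)\in\mathbb{Z}_+^{\mathcal{T}_n}$ is a Markov process: exogenous arrivals to each node form independent Poisson processes of rate $\lambda q$; service completions at node $i$ occur at instantaneous rate $\psi_i(\bar X(t))$ (driven by independent unit-rate Poisson processes). Upon a service completion at node $i$, the job leaves the system with probability $q$, or joins the queue of an adjacent node, each chosen with probability $(1-q)/(2d)$; routing decisions are independent of everything else. It is known from earlier work that for $\lambda<1/(2d+1)$ this finite system is stable (positive recurrent), so the stationary distribution exists and is unique; by symmetry all queues have the same stationary marginal distribution. *)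

(* Defs.v *)
From HB Require Import structures.
From mathcomp Require Import all_boot all_order all_algebra.
From mathcomp Require Import all_classical all_reals all_analysis.
Set Implicit Arguments.
Unset Strict Implicit.
Unset Printing Implicit Defensive.
Import Order.TTheory GRing.Theory Num.Theory.
Import numFieldNormedType.Exports.
Local Open Scope classical_set_scope.
Local Open Scope ring_scope.

(* The discrete torus (Z/2nZ)^d: the label set {-n, .., n-1}^d is represented
   by residues mod 2n.  'Z_(2 * n) is Z/2nZ only when n > 0. *)
Definition torus (d n : nat) := 'rV['Z_(2 * n)]_d.

Definition torus_adj (d n : nat) (i j : torus d n) : bool :=
  [exists k : 'I_d, (j == i + delta_mx 0 k) || (j == i - delta_mx 0 k)].

Definition nbhd (d n : nat) (i : torus d n) : {set torus d n} :=
  [set j | (j == i) || torus_adj i j].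

(* Queue-length configurations, a countable set with its discrete
   sigma-algebra. *)
Definition state (d n : nat) := {ffun torus d n -> nat}.
HB.instance Definition _ (d n : nat) := Countable.on (state d n).
HB.instance Definition _ (d n : nat) :=
  isPointed.Build (state d n) [ffun=> 0%N].
HB.instance Definition _ (d n : nat) :=
  @isMeasurable.Build default_measure_display (state d n)
    discrete_measurable discrete_measurable0
    discrete_measurableC discrete_measurableU.

Definition add_job (d n : nat) (x : state d n) (i : torus d n) : state d n :=
  [ffun k => (x k + (k == i))%N].

Definition remove_job (d n : nat) (x : state d n) (i : torus d n) : state d n :=
  [ffun k => (x k - (k == i))%N].

(* In a field a / 0 = 0, which is the convention 0 / 0 := 0 here: the
   denominator is at least x i. *)
Definition psi (R : realType) (d n : nat) (x : state d n) (i : torus d n) : R :=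
  (x i)%:R / (\sum_(j in nbhd i) x j)%:R.

(* The generator: each transition x -> x' occurring at rate r contributes
   r * (f x' - f x).  The truncated subtraction in remove_job is harmless,
   because psi x i = 0 when x i = 0. *)
Definition generator (R : realType) (d n : nat) (q lambda : R)
    (f : state d n -> R) (x : state d n) : R :=
  \sum_(i : torus d n)
    (lambda * q * (f (add_job x i) - f x)
     + psi R x i * q * (f (remove_job x i) - f x)
     + \sum_(j : torus d n | torus_adj i j)
         psi R x i * ((1 - q) / (2 * d)%:R)
           * (f (add_job (remove_job x i) j) - f x)).

(* The entry Q(x, y), y <> x, is the total rate of the transitions from x to y,
   and Q(x, x) is minus the total rate out of x. *)
Definition rate_matrix (R : realType) (d n : nat) (q lambda : R)
    (x y : state d n) : R :=
  generator q lambda (fun z => (z == y)%:R) x.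

(* P is the family of transition probabilities P_t(x, A), t >= 0, of a Markov
   process with transition rates Q (P at negative times is unconstrained). *)
Definition is_transition_function (R : realType) (disp : measure_display)
    (T : measurableType disp) (Q : T -> T -> R)
    (P : R -> R.-pker T ~> T) : Prop :=
  [/\ forall (x : T) (A : set T), measurable A -> P 0 x A = \d_x A,
      forall (s t : R) (x : T) (A : set T), 0 <= s -> 0 <= t -> measurable A ->
        P (s + t) x A = kcomp_noparam (P s) (P t) x A
    & forall x y : T,
        (fine (P h x [set y]) - (x == y)%:R) / h @[h --> 0^'+] --> Q x y].

Definition is_stationary (R : realType) (disp : measure_display)
    (T : measurableType disp) (P : R -> R.-pker T ~> T)
    (mu : probability T R) : Prop :=
  forall (t : R) (A : set T), 0 <= t -> measurable A ->
    (\int[mu]_x P t x A)%E = mu A.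

(* Main.v *)
(* The transition rates are bounded, so stationarity of mu passes to the limit
   h -> 0 and yields the balance equations, hence the vanishing of the mu-mean
   of [generator f] for every bounded f.

   Let |x| be the number of jobs, N the number of nodes, D the degree plus one,
   S_i the number of jobs around i, and
     W(x) = sum_i x_i^2 + (2 - q) / q * |x|.
   As psi_i S_i = x_i, the routing part of the drift of sum_i x_i^2 is, up to a
   multiple of sum_i psi_i, proportional to |x| - D sum_i psi_i x_i, which is
   nonpositive because Cauchy-Schwarz gives sum_i x_i^2 / S_i >= |x| / D.
   The departures contribute - 2 q sum_i psi_i x_i, so that in total the drift
   of W is at most 2 lambda N - 2 q (1 / (2d + 1) - lambda) |x|.  Applying the
   vanishing mean to min(W, K) and letting K tend to infinity bounds the mean
   of |x|.

   The bound for one queue follows from translation invariance of mu: testing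
   the balance equations against the indicator of the set of states which weigh
   more than their translates shows that this set is closed under transitions;
   were it nonempty it would contain the empty configuration, which is its own
   translate. *)
Require Import Defs.
From HB Require Import structures.
From mathcomp Require Import all_boot all_order all_algebra.
From mathcomp Require Import all_classical all_reals all_analysis.
From mathcomp Require Import ring lra.
Set Implicit Arguments.
Unset Strict Implicit.
Unset Printing Implicit Defensive.
Import Order.TTheory GRing.Theory Num.Theory.
Import numFieldNormedType.Exports.
Local Open Scope classical_set_scope.
Local Open Scope ring_scope.

(** * Limits of finite sums; adjacency and translations on the torus *)

Lemma cvg_sumr (R : realType) (I : Type) (r : seq I) (P : pred I)
    (u : I -> nat -> R) (l : I -> R) :
  (forall i, P i -> u i k @[k --> \oo] --> l i) ->
  (\sum_(i <- r | P i) u i k) @[k --> \oo] --> \sum_(i <- r | P i) l i.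
Proof.
move=> ul; elim: r => [|i r IH].
  by under eq_fun do rewrite big_nil; rewrite big_nil; exact: cvg_cst.
rewrite big_cons; under eq_fun do rewrite big_cons.
by case: ifP => // Pi; apply: cvgD => //; exact: ul.
Qed.

Lemma torus_adj_sym (d n : nat) (i j : torus d n) :
  torus_adj i j = torus_adj j i.
Proof.
by apply/existsP/existsP => -[k /orP[]/eqP->]; exists k;
  rewrite ?addrK ?subrK eqxx ?orbT.
Qed.

Lemma torus_adj_irr (d n : nat) (i : torus d n) : torus_adj i i = false.
Proof.
apply/existsP => -[k] /orP[]; rewrite -{1}[i]addr0 (inj_eq (addrI i)) eq_sym
  ?oppr_eq0 => /eqP/matrixP/(_ 0 k)/eqP;
  by rewrite !mxE !eqxx ?oppr_eq0 oner_eq0.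
Qed.

Lemma torus_adj_shift (d n : nat) (v i j : torus d n) :
  torus_adj (i + v) (j + v) = torus_adj i j.
Proof.
by apply: eq_existsb => k; rewrite 2!(addrAC i v) !(inj_eq (addIr v)).
Qed.

Definition degree (d n : nat) : nat := #|torus_adj (0 : torus d n)|.

Lemma card_torus_adj (d n : nat) (i : torus d n) :
  #|torus_adj i| = degree d n.
Proof.
rewrite /degree -(card_imset (torus_adj 0) (addIr i)).
apply: eq_card => j; rewrite -[LHS]/(torus_adj i j).
apply/idP/imsetP => [ij|[k k0 ->]].
  exists (j - i); last by rewrite subrK.
  by rewrite -[_ \in _]/(torus_adj _ _) -(torus_adj_shift i) add0r subrK.
by rewrite -{1}[i]add0r torus_adj_shift.
Qed.

(** The [2 * d] signed unit vectors exhaust the neighbours of [0], possibly with repetitions. *)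
Lemma degree_le (d n : nat) : (degree d n <= 2 * d)%N.
Proof.
pose e (u : bool * 'I_d) : torus d n :=
  if u.1 then delta_mx 0 u.2 else - delta_mx 0 u.2.
apply: (@leq_trans #|[set e u | u : bool * 'I_d]%SET|).
  apply/subset_leq_card/fintype.subsetP => j /existsP[k /orP[]/eqP->].
    by apply/imsetP; exists (true, k); rewrite //= add0r.
  by apply/imsetP; exists (false, k); rewrite //= add0r.
by rewrite (leq_trans (leq_imset_card _ _))// card_prod card_bool card_ord.
Qed.

Lemma sum_nbhd (V : nmodType) (d n : nat) (i : torus d n) (F : torus d n -> V) :
  \sum_(j in nbhd i) F j = F i + \sum_(j | torus_adj i j) F j.
Proof.
rewrite (bigD1 i) /=; last by rewrite inE eqxx.
congr (_ + _); apply: eq_bigl => j; rewrite inE.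
by case: eqVneq => //= [->|_]; rewrite ?torus_adj_irr ?andbT.
Qed.

(** The configuration seen from [v]: node [0] of [shift v x] carries queue [v] of [x]. *)
Definition shift {d n : nat} (v : torus d n) (x : state d n) : state d n :=
  [ffun k => x (k + v)].

Lemma shiftK (d n : nat) (v : torus d n) : cancel (shift v) (shift (- v)).
Proof. by move=> x; apply/ffunP => k; rewrite !ffunE subrK. Qed.

Lemma shiftNK (d n : nat) (v : torus d n) : cancel (shift (- v)) (shift v).
Proof. by move=> x; apply/ffunP => k; rewrite !ffunE addrK. Qed.

Lemma shift_add_job (d n : nat) (v : torus d n) (x : state d n) i :
  shift v (add_job x (i + v)) = add_job (shift v x) i.
Proof. by apply/ffunP => k; rewrite !ffunE (inj_eq (addIr v)). Qed.

Lemma shift_remove_job (d n : nat) (v : torus d n) (x : state d n) i :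
  shift v (remove_job x (i + v)) = remove_job (shift v x) i.
Proof. by apply/ffunP => k; rewrite !ffunE (inj_eq (addIr v)). Qed.

(** * Service rates and generator: symmetry, linearity, comparison, bounds *)

Section generator.
Context {R : realType} {d n : nat}.
Implicit Types (x y : state d n) (i j v : torus d n) (f g : state d n -> R).

Lemma psi_ge0 x i : 0 <= psi R x i.
Proof. by rewrite divr_ge0 ?ler0n. Qed.

Lemma psi_le1 x i : psi R x i <= 1.
Proof.
rewrite /psi (sum_nbhd i (fun j => x j)).
set S := (_ + _)%R; have [->|S0] := posnP S; first by rewrite invr0 mulr0.
by rewrite ler_pdivrMr ?ltr0n// mul1r ler_nat leq_addr.
Qed.

Lemma psi_gt0 x i : (0 < x i)%N -> 0 < psi R x i.
Proof.
move=> xi; rewrite divr_gt0 ?ltr0n// (sum_nbhd i (fun j => x j)).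
by rewrite (leq_trans xi)// leq_addr.
Qed.

Lemma psi_eq0 x i : x i = 0%N -> psi R x i = 0.
Proof. by rewrite /psi => ->; rewrite mul0r. Qed.

(** Division-free form of the service rates, valid also for an empty neighbourhood, where both sides
    vanish. *)
Lemma psi_mul_nbhd x i :
  psi R x i * ((x i)%:R + \sum_(j | torus_adj i j) (x j)%:R) = (x i)%:R.
Proof.
rewrite -sum_nbhd -natr_sum; have [xi0|xi] := posnP (x i).
  by rewrite psi_eq0// mul0r xi0.
rewrite /psi divfK// pnatr_eq0 -lt0n (sum_nbhd i (fun j => x j)).
by rewrite (leq_trans xi)// leq_addr.
Qed.

Lemma psi_shift v x i : psi R (shift v x) i = psi R x (i + v).
Proof.
rewrite /psi ffunE; congr (_ / _%:R).
rewrite [RHS](reindex_inj (addIr v)); apply: eq_big => [j|j _]; last first.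
  by rewrite ffunE.
by rewrite !inE torus_adj_shift (inj_eq (addIr v)).
Qed.

Context {q lambda : R}.
Local Notation G := (generator q lambda).

Lemma generator_shift v f x : G (f \o shift v) x = G f (shift v x).
Proof.
rewrite /generator [LHS](reindex_inj (addIr v)); apply: eq_bigr => i _ /=.
rewrite !shift_add_job !shift_remove_job !psi_shift; congr (_ + _).
rewrite [LHS](reindex_inj (addIr v)); apply: eq_big => [j|j _].
  by rewrite torus_adj_shift.
by rewrite shift_add_job shift_remove_job.
Qed.

Lemma generator_linear (a : R) f g x :
  G (fun z => a * f z + g z) x = a * G f x + G g x.
Proof.
rewrite /generator mulr_sumr -big_split; apply: eq_bigr => i _ /=.
rewrite [in RHS]mulrDr mulr_sumr [RHS]addrACA -big_split /=.
congr (_ + _); first by ring.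
by apply: eq_bigr => j _; ring.
Qed.

Lemma generator_cst (a : R) x : G (fun=> a) x = 0.
Proof.
rewrite /generator big1// => i _; rewrite !subrr !mulr0 !add0r.
by rewrite big1// => j _; rewrite mulr0.
Qed.

Lemma generator_sum (I : Type) (r : seq I) (a : I -> R)
    (f : I -> state d n -> R) x :
  G (fun z => \sum_(k <- r) a k * f k z) x = \sum_(k <- r) a k * G (f k) x.
Proof.
elim: r => [|k r IH].
  rewrite big_nil -[RHS](generator_cst 0 x); congr (G _ x).
  by apply/funext => z; rewrite big_nil.
rewrite big_cons -IH -generator_linear; congr (G _ x).
by apply/funext => z; rewrite big_cons.
Qed.

Lemma cvg_generator (u : nat -> state d n -> R) f x :
  (forall y, u k y @[k --> \oo] --> f y) ->
  G (u k) x @[k --> \oo] --> G f x.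
Proof.
move=> uf; have uB (a : R) y z :
    a * (u k y - u k z) @[k --> \oo] --> a * (f y - f z).
  by apply: cvgM; [exact: cvg_cst|apply: cvgB; exact: uf].
rewrite /generator; apply: cvg_sumr => i _.
apply: cvgD; first by apply: cvgD; exact: uB.
by apply: cvg_sumr => j _; exact: uB.
Qed.

Hypotheses (q_gt0 : 0 < q) (q_lt1 : q < 1) (lambda_ge0 : 0 <= lambda).

(** All transition rates are nonnegative. With a constant [f] or [g] this becomes a maximum
    principle. *)
Lemma generator_le f g x :
  (forall y, f y - f x <= g y - g x) -> G f x <= G g x.
Proof.
move=> fg; have psi0 := psi_ge0 x.
rewrite /generator; apply: ler_sum => i _.
apply: lerD; [apply: lerD|apply: ler_sum => j _];
  apply: ler_wpM2l => //;
  by rewrite ?mulr_ge0 ?invr_ge0 ?subr_ge0 ?(ltW q_gt0) ?(ltW q_lt1).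
Qed.

(** Bound on the total transition rate, uniform in the state: every [psi] is replaced by 1. *)
Definition rate_bound : R :=
  \sum_(i : torus d n) (lambda * q + q
    + \sum_(j : torus d n | torus_adj i j) (1 - q) / (2 * d)%:R).

Lemma generator_bound (M : R) f x : (forall y, `|f y - f x| <= M) ->
  `|G f x| <= rate_bound * M.
Proof.
move=> fM; have psi0 := psi_ge0 x; have psi1 := psi_le1 x.
have r0 : 0 <= (1 - q) / (2 * d)%:R by rewrite divr_ge0 ?ler0n// subr_ge0 ltW.
have M0 : 0 <= M by rewrite (le_trans _ (fM x)).
rewrite /generator /rate_bound [in leRHS]mulr_suml (le_trans (ler_norm_sum _ _ _))//.
apply: ler_sum => i _.
move: (psi R x i) (psi0 i) (psi1 i) => p p0 p1; rewrite [leRHS]mulrDl [in leRHS]mulr_suml.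
apply: (le_trans (ler_normD _ _)); apply: lerD.
  rewrite mulrDl (le_trans (ler_normD _ _))// !normrM.
  rewrite !(ger0_norm lambda_ge0) !(gtr0_norm q_gt0) (ger0_norm p0).
  apply: lerD; first by rewrite ler_wpM2l ?mulr_ge0 ?(ltW q_gt0).
  by apply: ler_pM; rewrite ?mulr_ge0 ?ler_piMl ?(ltW q_gt0).
apply: (le_trans (ler_norm_sum _ _ _)); apply: ler_sum => j _.
rewrite normrM (ger0_norm (mulr_ge0 p0 r0)).
by apply: ler_pM => //; [exact: mulr_ge0|exact: ler_piMl].
Qed.

End generator.

(** * Drift of the Lyapunov function *)

Section lyapunov.
Context {R : realType} {d n : nat}.
Implicit Types (x : state d n) (i j : torus d n).

(** Separable functions: a transition changes only the summands of the nodes that it touches. *)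
Definition sep (h : nat -> R) x : R := \sum_i h (x i).

Lemma sep_add (h : nat -> R) x i :
  sep h (add_job x i) - sep h x = h (x i).+1 - h (x i).
Proof.
rewrite /sep (bigD1 i)//= [X in _ - X](bigD1 i)//= !ffunE eqxx addn1.
rewrite (eq_bigr (fun j => h (x j))); first by rewrite opprD addrACA subrr addr0.
by move=> j /negPf ji; rewrite ffunE ji addn0.
Qed.

Lemma sep_remove (h : nat -> R) x i :
  sep h (remove_job x i) - sep h x = h (x i).-1 - h (x i).
Proof.
rewrite /sep (bigD1 i)//= [X in _ - X](bigD1 i)//= !ffunE eqxx subn1.
rewrite (eq_bigr (fun j => h (x j))); first by rewrite opprD addrACA subrr addr0.
by move=> j /negPf ji; rewrite ffunE ji subn0.
Qed.

Lemma sep_move (h : nat -> R) x i j : i != j ->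
  sep h (add_job (remove_job x i) j) - sep h x =
    h (x j).+1 - h (x j) + (h (x i).-1 - h (x i)).
Proof.
move=> ij; rewrite -sep_remove -[LHS](subrKA (sep h (remove_job x i))).
by rewrite sep_add ffunE [j == i]eq_sym (negPf ij) subn0.
Qed.

Context {q lambda : R}.
Hypotheses (d_gt0 : (1 <= d)%N) (q_gt0 : 0 < q) (q_lt1 : q < 1).
Local Notation G := (generator q lambda).

(* The linear term is chosen so that, on average, the contributions of the
   departure rates psi to the drift cancel. *)
Definition lyap : state d n -> R :=
  sep (fun m => m%:R ^+ 2 + (2 - q) / q * m%:R).

(** Double counting: each queue is seen from [degree d n] nodes. *)
Lemma sum_neighbours x :
  \sum_i \sum_(j | torus_adj i j) (x j)%:R = (degree d n)%:R * \sum_i (x i)%:R :> R.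
Proof.
rewrite (exchange_big_dep xpredT)//= mulr_sumr; apply: eq_bigr => j _.
rewrite sumr_const -(card_torus_adj j) mulr_natl; congr (_ *+ _).
by apply: eq_card => i; rewrite -[LHS]/(torus_adj i j) torus_adj_sym.
Qed.

(* Cauchy-Schwarz in tangent form: S (psi - t)^2 >= 0 with S the total
   number of jobs around i, psi * S = x i and t = 1 / (degree + 1). *)
Lemma sum_psi_mul_ge x :
  \sum_i (x i)%:R <= (degree d n).+1%:R * \sum_i psi R x i * (x i)%:R.
Proof.
set m := degree d n; pose t : R := m.+1%:R^-1.
have mt : m.+1%:R * t = 1 by rewrite mulfV// pnatr_eq0.
have t0 : 0 < t by rewrite invr_gt0 ltr0n.
pose nb i : R := \sum_(j | torus_adj i j) (x j)%:R.
have le_i i : t * (2 * (x i)%:R - t * ((x i)%:R + nb i)) <= psi R x i * (x i)%:R.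
  have S0 : 0 <= (x i)%:R + nb i by rewrite addr_ge0 ?sumr_ge0.
  have := psi_mul_nbhd (R := R) x i; rewrite -/(nb i).
  move: (psi R x i) ((x i)%:R + nb i) S0 => p S S0 <-.
  by have := mulr_ge0 S0 (sqr_ge0 (p - t)); lra.
have := ler_sum (index_enum _) (fun i (_ : true) => le_i i).
rewrite -mulr_sumr sumrB -!mulr_sumr big_split/= sum_neighbours -/m.
set X := \sum_i (x i)%:R; set Y := \sum_i _; rewrite -natr1 in mt *.
have -> : t * (2 * X - t * (X + m%:R * X)) = t * X * (2 - (m%:R + 1) * t) by ring.
rewrite mt => XY; have X_E : X = (m%:R + 1) * (t * X) by rewrite mulrA mt mul1r.
by rewrite [leLHS]X_E ler_wpM2l ?addr_ge0//; lra.
Qed.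

(** The truncated predecessor is harmless at an empty queue, since [psi] vanishes there. The factor
    [e] stands for the probability of leaving or of one route. *)
Lemma psi_mul_remove_quadratic (c e : R) x i :
  psi R x i * e * ((x i).-1%:R ^+ 2 + c * (x i).-1%:R
                   - ((x i)%:R ^+ 2 + c * (x i)%:R))
    = psi R x i * e * (1 - c - 2 * (x i)%:R).
Proof.
case: (posnP (x i)) => [xi0|xi]; first by rewrite psi_eq0// !mul0r.
by rewrite -(prednK xi) /=; move: (psi _ _ _) => p; rewrite -!natr1; ring.
Qed.

Lemma generator_lyap_le x :
  G lyap x <= 2 * lambda * #|{: torus d n}|%:R
    - 2 * q * ((2 * d + 1)%:R^-1 - lambda) * \sum_i (x i)%:R.
Proof.
pose a := (2 - q) / q; pose h (m : nat) : R := m%:R ^+ 2 + a * m%:R.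
have qa : q * a = 2 - q by rewrite /a mulrC divfK// gt_eqF.
pose r := (1 - q) / (2 * d)%:R; set m := degree d n.
have r0 : 0 <= r by rewrite divr_ge0// subr_ge0 ltW.
have rm : r * m%:R <= 1 - q.
  rewrite /r mulrAC ler_pdivrMr ?ltr0n ?muln_gt0//.
  by rewrite ler_wpM2l ?subr_ge0 ?(ltW q_lt1)// ler_nat degree_le.
pose p i := psi R x i; pose nb i : R := \sum_(j | torus_adj i j) (x j)%:R.
have -> : G lyap x = \sum_i (lambda * q * (1 + a) + lambda * q * 2 * (x i)%:R
    + (q * (1 - a) + 2 * r * m%:R) * p i - 2 * q * (p i * (x i)%:R)
    + 2 * r * ((x i)%:R - m.+1%:R * (p i * (x i)%:R))).
  rewrite /generator /lyap; apply: eq_bigr => i _.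
  rewrite (eq_bigr (fun j => p i * r * (2 - 2 * (x i)%:R) + 2 * r * p i * (x j)%:R)).
    rewrite sep_add sep_remove psi_mul_remove_quadratic -/a -/(p i).
    rewrite big_split/= sumr_const -mulr_sumr -/(nb i).
    rewrite (_ : #|_| = m); last exact: card_torus_adj.
    (* Eliminates the neighbour sum, so that only [x i] and [p i] remain. *)
    have /(canRL (addKr _)) E : p i * (x i)%:R + p i * nb i = (x i)%:R.
      by rewrite -mulrDr; exact: psi_mul_nbhd.
    rewrite -(mulrA (2 * r)) E -[_ *+ m]mulr_natr -!natr1.
    by move: (p i) => pp; ring.
  move=> j ij; rewrite sep_move; last first.
    by apply: contraTneq ij => ->; rewrite torus_adj_irr.
  rewrite mulrDr psi_mul_remove_quadratic -/a -/(p i) -/r.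
  by rewrite -natr1; move: (p i) => pp; ring.
rewrite !big_split/= sumr_const -[_ *+ #|_|]mulr_natr !sumrN -!mulr_sumr sumrB.
rewrite -!mulr_sumr (_ : #|_| = #|{: torus d n}|)//; set N : R := #|_|%:R.
have := sum_psi_mul_ge x; rewrite -/m -/p.
have : 0 <= \sum_i p i by apply: sumr_ge0 => i _; exact: psi_ge0.
have : 0 <= \sum_i (x i)%:R :> R by exact: sumr_ge0.
set X := \sum_i (x i)%:R; set Y := \sum_i _ * _; set Z := \sum_i _.
move=> X0 Z0 XY.
have XYd : (2 * d + 1)%:R^-1 * X <= Y.
  rewrite mulrC ler_pdivrMr ?ltr0n ?addn1// mulrC (le_trans XY)//.
  by rewrite ler_wpM2r ?ler_nat ?ltnS ?degree_le// sumr_ge0// => i _; rewrite mulr_ge0 ?psi_ge0.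
(* [H1] controls routing, [H2] the sum of the [p i], whose coefficient is [-2 * (1 - q - r * m)],
   and [H3] the departures; [H4] evaluates the arrivals. *)
have H1 : 0 <= r * (m.+1%:R * Y - X) by rewrite mulr_ge0// subr_ge0.
have H2 : 0 <= (1 - q - r * m%:R) * Z by rewrite mulr_ge0// subr_ge0.
have H3 : 0 <= q * (Y - (2 * d + 1)%:R^-1 * X) by rewrite mulr_ge0 ?subr_ge0 ?(ltW q_gt0).
have H4 : lambda * q * (1 + a) * N = 2 * lambda * N.
  by rewrite -[lambda * q * _]mulrA mulrDr qa; ring.
rewrite H4 (_ : q * (1 - a) = 2 * q - 2); last by rewrite mulrBr qa; ring.
by lra.
Qed.

End lyapunov.

(** * Integrals of bounded functions of the state *)

Section bounded_integral.
Context {R : realType} {d n : nat} (mu : probability (state d n) R).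
Implicit Types (x y : state d n) (f g : state d n -> R) (M : R).

Lemma measurable_state (A : set (state d n)) : measurable A.
Proof. by []. Qed.

Lemma integrable_bounded M f : (forall x, `|f x| <= M) ->
  mu.-integrable setT (EFin \o f).
Proof.
move=> fM; apply: measurable_bounded_integrable => //.
- by rewrite (@le_lt_trans _ _ 1%E) ?probability_le1 ?ltry.
- exists M; split; first exact: num_real.
  by move=> K MK x _; exact: le_trans (fM x) (ltW MK).
Qed.

Lemma Rintegral_indic (A : set (state d n)) :
  \int[mu]_x (x \in A)%:R = fine (mu A).
Proof.
rewrite /Rintegral -[in RHS](setIT A) -integral_indic//.
Qed.

Lemma Rintegral_sum (I : Type) (r : seq I) (M : I -> R) (a : I -> R)
    (f : I -> state d n -> R) : (forall i x, `|f i x| <= M i) ->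
  \int[mu]_x (\sum_(i <- r) a i * f i x) = \sum_(i <- r) a i * \int[mu]_x f i x.
Proof.
move=> fM; elim: r => [|i r IH].
  rewrite big_nil; under eq_Rintegral do rewrite big_nil.
  by rewrite Rintegral_cst// mul0r.
rewrite big_cons -IH -RintegralZl//; last exact: integrable_bounded (fM i).
rewrite -RintegralD//.
- by apply: eq_Rintegral => x _; rewrite big_cons.
- apply: (@integrable_bounded (`|a i| * M i)) => x.
  by rewrite normrM ler_wpM2l.
- apply: (@integrable_bounded (\sum_(j <- r) `|a j| * M j)) => x.
  rewrite (le_trans (ler_norm_sum _ _ _))//; apply: ler_sum => j _.
  by rewrite normrM ler_wpM2l.
Qed.

Lemma bounded_cvg_Rintegral M (u : nat -> state d n -> R) f :
  (forall k x, `|u k x| <= M) -> (forall x, u k x @[k --> \oo] --> f x) ->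
  \int[mu]_x u k x @[k --> \oo] --> \int[mu]_x f x.
Proof.
move=> uM uf.
have [| | | | |fi _ ]:= @dominated_convergence _ _ _ mu setT measurableT
  (fun k x => (u k x)%:E) (EFin \o f) (cst M%:E).
- by [].
- by [].
- by apply: aeW => x _; apply: cvg_EFin (uf x); exact: nearW.
- by apply: (@integrable_bounded `|M| (cst M)).
- by apply: aeW => x k _; rewrite lee_fin.
move=> H; apply: fine_cvg; rewrite fineK; first exact: H.
exact: integrable_fin_num fi.
Qed.

End bounded_integral.

(** * From stationarity to the balance equations *)

Section stationary.
Context {R : realType} {d n : nat} {q lambda : R}.
Implicit Types (x y : state d n) (i j v : torus d n) (f g : state d n -> R).
Hypotheses (q_gt0 : 0 < q) (q_lt1 : q < 1) (lambda_ge0 : 0 <= lambda).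
Variable P : R -> R.-pker (state d n) ~> (state d n).
Hypothesis hP : is_transition_function (rate_matrix q lambda) P.

Local Notation C := (@rate_bound R d n q lambda).
Local Notation p := (fun h x y => fine (P h x [set y])).

Lemma pker_le1 h x (A : set (state d n)) : (P h x A <= 1)%E.
Proof. by rewrite -(prob_kernel (s := P h) x); apply: le_measure; rewrite ?inE. Qed.

Lemma pker_fin_num h x (A : set (state d n)) : P h x A \is a fin_num.
Proof.
by rewrite ge0_fin_numE// (le_lt_trans (pker_le1 _ _ _))// ltry.
Qed.

Lemma trans_ge0 h x y : 0 <= p h x y.
Proof. by rewrite fine_ge0. Qed.

Lemma trans_le1 h x y : p h x y <= 1.
Proof. by rewrite -lee_fin fineK ?pker_fin_num// pker_le1. Qed.

Lemma trans_add_le1 h x y : y != x -> p h x y + p h x x <= 1.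
Proof.
move=> yx; rewrite -lee_fin EFinD !fineK ?pker_fin_num//.
rewrite -measureU// ?pker_le1//.
by apply/seteqP; split=> // z [/= -> xy]; move: yx; rewrite xy eqxx.
Qed.

Lemma norm_rate_matrix_le x y : `|rate_matrix q lambda x y| <= C.
Proof.
rewrite -[leRHS]mulr1; apply: generator_bound => // z.
by case: (z == y); case: (x == y);
  rewrite ?subrr ?subr0 ?sub0r ?normrN ?normr0 ?normr1.
Qed.

(* Chapman-Kolmogorov gives p_2h(x, x) >= p_h(x, x)^2. *)
Lemma one_sub_trans_double h x : 0 <= h ->
  1 - p (2 * h) x x <= 2 * (1 - p h x x).
Proof.
move=> h0; have [_ CK _] := hP.
suff : p h x x * p h x x <= p (2 * h) x x.
  by have := sqr_ge0 (1 - p h x x); rewrite expr2; lra.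
rewrite -lee_fin EFinM !fineK ?pker_fin_num// mulrDl mul1r.
rewrite (CK h h x [set x])// /kcomp_noparam.
have -> : (P h x [set x] * P h x [set x] =
    \int[P h x]_y (P h x [set x] * (\1_[set x] y)%:E))%E.
  by rewrite ge0_integralZl// integral_indic// setIT.
apply: ge0_le_integral => //.
move=> y _; rewrite indicE; case: (boolP (y \in _)) => [|_].
  by rewrite inE/= => ->; rewrite mule1.
by rewrite mule0.
Qed.

(** By [one_sub_trans_double], halving the time can only increase the quotient. Hence it is at most
    its limit along [h / 2 ^+ k], which is minus the diagonal rate. *)
Lemma one_sub_trans_le h x : 0 < h -> (1 - p h x x) / h <= C.
Proof.
move=> h0; pose D t := (1 - p t x x) / t.
have D2 t : 0 < t -> D (2 * t) <= D t.
  move=> t0; rewrite /D ler_pdivrMr ?mulr_gt0//.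
  rewrite mulrCA divfK ?gt_eqF//; exact: one_sub_trans_double (ltW t0).
have Dk k : D h <= D (h / 2 ^+ k).
  elim: k => [|k IH]; first by rewrite expr0 divr1.
  rewrite (le_trans IH)// (le_trans _ (D2 _ _)) ?divr_gt0 ?exprn_gt0//.
  by rewrite exprS invfM mulrCA [2 * _]mulrA mulfV// mul1r.
have [_ _ /(_ x x)] := hP; rewrite eqxx => /cvg_at_rightP/(_ (fun k => h / 2 ^+ k)).
have hk : (forall k, 0 < h / 2 ^+ k) /\ h / 2 ^+ k @[k --> \oo] --> 0.
  split=> [k|]; first by rewrite divr_gt0 ?exprn_gt0.
  rewrite -[0](mulr0 h); apply: cvgMr.
  under eq_fun do rewrite -exprVn.
  by apply: cvg_expr; rewrite ger0_norm ?invf_lt1 ?ltr1n.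
move=> /(_ hk) Dlim.
have {}Dlim : - D (h / 2 ^+ k) @[k --> \oo] --> rate_matrix q lambda x x.
  apply: cvg_trans Dlim; apply: near_eq_cvg; apply: nearW => k /=.
  by rewrite /D -mulNr opprB.
have := norm_rate_matrix_le x x; rewrite ler_norml => /andP[+ _]; rewrite lerNl.
apply: le_trans; rewrite lerNr.
rewrite -(cvg_lim _ Dlim)//; apply: limr_le; first by apply/cvg_ex; eexists; exact: Dlim.
by apply: nearW => k; rewrite lerN2.
Qed.

(** The probability of reaching another state is at most that of having left [x]. The bound is
    uniform in [h] and [x], as dominated convergence requires. *)
Lemma difference_quotient_le h x y : 0 < h ->
  `|(p h x y - (x == y)%:R) / h| <= C.
Proof.
move=> h0; apply: le_trans (one_sub_trans_le x h0).
rewrite normrM (gtr0_norm (x := h^-1)) ?invr_gt0// ler_wpM2r ?invr_ge0 ?(ltW h0)//.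
case: eqVneq => [<-|xy].
  by rewrite distrC ger0_norm// subr_ge0 trans_le1.
rewrite subr0 ger0_norm ?trans_ge0// lerBrDr trans_add_le1//.
by rewrite eq_sym.
Qed.

Variable mu : probability (state d n) R.
Hypothesis hmu : is_stationary P mu.

Lemma balance y : \int[mu]_x rate_matrix q lambda x y = 0.
Proof.
pose h k : R := k.+1%:R^-1.
have h0 k : 0 < h k by rewrite invr_gt0 ltr0n.
have hlim : h k @[k --> \oo] --> 0 by exact: cvg_harmonic.
have [_ _ /(_ _ y) Q] := hP.
have : \int[mu]_x ((p (h k) x y - (x == y)%:R) / h k) @[k --> \oo] -->
    \int[mu]_x rate_matrix q lambda x y.
  apply: (@bounded_cvg_Rintegral _ _ _ mu C).
    by move=> k x; exact: difference_quotient_le.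
  by move=> x; move/cvg_at_rightP: (Q x); apply; split.
(* By stationarity both terms of the numerator have mean [mu [set y]]. *)
suff E k : \int[mu]_x ((p (h k) x y - (x == y)%:R) / h k) = 0.
  under eq_fun do rewrite E.
  by move=> /(cvg_unique _); apply => //; exact: cvg_cst.
have pi : mu.-integrable setT (EFin \o (fun x => p (h k) x y)).
  by apply: (@integrable_bounded _ _ _ mu 1) => x; rewrite ger0_norm ?trans_ge0 ?trans_le1.
have di : mu.-integrable setT (EFin \o (fun x => (x == y)%:R)).
  apply: (@integrable_bounded _ _ _ mu 1) => x.
  by case: (x == y); rewrite ?normr0 ?normr1.
rewrite RintegralZr//; last first.
  apply: (@integrable_bounded _ _ _ mu 1) => x; rewrite ler_norml.
  by have := trans_ge0 (h k) x y; have := trans_le1 (h k) x y; case: (x == y) => /=; lra.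
rewrite RintegralB// (_ : \int[mu]_x p _ x y = fine (mu [set y])); last first.
  rewrite -(hmu (ltW (h0 k)) (measurable_state [set y])) /Rintegral; congr fine.
  by apply: eq_integral => x _; rewrite fineK ?pker_fin_num.
rewrite -(Rintegral_indic mu [set y]) (_ : \int[mu]_x (x == y)%:R =
  \int[mu]_x (x \in [set y])%:R) ?subrr ?mul0r//.
apply: eq_Rintegral => x _; case: eqVneq => [->|/eqP xy]; first by rewrite mem_set.
by rewrite memNset.
Qed.

End stationary.

(** * Finite truncations of functions on a countable type *)

Section truncation.
Context {R : realType} {T : countType}.
Implicit Types (x y : T) (f : T -> R) (K : nat).

Definition first_elts K : seq T := pmap pickle_inv (iota 0 K).

Lemma mem_first_elts K x : (x \in first_elts K) = (pickle x < K)%N.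
Proof.
rewrite mem_pmap; apply/mapP/idP => [[k]|xK].
  rewrite mem_iota /= add0n => kK xk.
  by have := pickle_invK (T := T) k; rewrite -xk /= => ->.
by exists (pickle x); rewrite ?mem_iota// pickleK_inv.
Qed.

Lemma first_elts_uniq K : uniq (first_elts K).
Proof.
exact: (pmap_uniq (@pickle_invK T)) (iota_uniq _ _).
Qed.

(** Written as a finite combination of indicators, so that linearity reduces its generator to
    entries of the rate matrix. *)
Definition trunc K f x : R := \sum_(y <- first_elts K) f y * (x == y)%:R.

Lemma truncE K f x : trunc K f x = if (pickle x < K)%N then f x else 0.
Proof.
rewrite /trunc -mem_first_elts; case: ifPn => xK.
  rewrite (bigD1_seq x) ?first_elts_uniq//= eqxx mulr1 big1 ?addr0// => y.
  by rewrite eq_sym => /negPf ->; rewrite mulr0.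
rewrite big1_seq// => y /andP[_ yK]; case: eqVneq => [xy|]; last by rewrite mulr0.
by rewrite xy yK in xK.
Qed.

Lemma norm_trunc_le (M : R) K f x : (forall y, `|f y| <= M) -> `|trunc K f x| <= M.
Proof.
by move=> fM; rewrite truncE; case: ifP => // _; rewrite normr0 (le_trans _ (fM x)).
Qed.

Lemma cvg_trunc f x : trunc K f x @[K --> \oo] --> f x.
Proof.
apply: cvg_near_cst; exists (pickle x).+1 => // K /= xK.
by apply/eqP; rewrite truncE xK.
Qed.

End truncation.

(** * Vanishing mean of the generator and translation invariance of [mu] *)

Section invariant_mean.
Context {R : realType} {d n : nat} {q lambda : R}.
Implicit Types (x y : state d n) (i j v : torus d n) (f g : state d n -> R).
Hypotheses (q_gt0 : 0 < q) (q_lt1 : q < 1) (lambda_ge0 : 0 <= lambda).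
Variable mu : probability (state d n) R.
Hypothesis mu_balance : forall y, \int[mu]_x rate_matrix q lambda x y = 0.

Local Notation G := (generator q lambda).
Local Notation C := (@rate_bound R d n q lambda).
Local Notation p := (fun x => fine (mu [set x])).

Lemma norm_generator_le (M : R) f x : (forall y, `|f y| <= M) ->
  `|G f x| <= C * (2 * M).
Proof.
move=> fM; apply: generator_bound => // y.
by rewrite (le_trans (ler_normB _ _))// mulr_natl mulr2n lerD.
Qed.

(** For truncations this is a finite combination of balance equations; dominated convergence gives
    bounded [f]. *)
Lemma Rintegral_generator (M : R) f : (forall y, `|f y| <= M) ->
  \int[mu]_x G f x = 0.
Proof.
move=> fM.
have : \int[mu]_x G (trunc K f) x @[K --> \oo] --> \int[mu]_x G f x.
  apply: (@bounded_cvg_Rintegral _ _ _ mu (C * (2 * M))).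
    by move=> K x; apply: norm_generator_le => y; exact: norm_trunc_le.
  by move=> x; apply: cvg_generator => y; exact: cvg_trunc.
suff E K : \int[mu]_x G (trunc K f) x = 0.
  under eq_fun do rewrite E.
  by move=> /(cvg_unique _); apply => //; exact: cvg_cst.
under eq_Rintegral do rewrite /trunc generator_sum.
rewrite (@Rintegral_sum _ _ _ mu _ _ (fun=> C)).
  by rewrite big1// => y _; rewrite -/(rate_matrix _ _ _ _) mu_balance mulr0.
by move=> y x; exact: norm_rate_matrix_le.
Qed.

(** Change of variables: the image of [mu] under [shift v] gives [y] the mass of [shift (- v) y]. *)
Lemma cvg_sum_shift (M : R) f v : (forall y, `|f y| <= M) ->
  \sum_(y <- first_elts K) f y * p (shift (- v) y) @[K --> \oo]
    --> \int[mu]_x f (shift v x).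
Proof.
move=> fM.
have H : \int[mu]_x trunc K f (shift v x) @[K --> \oo]
    --> \int[mu]_x f (shift v x).
  apply: (@bounded_cvg_Rintegral _ _ _ mu M).
    by move=> K x; exact: norm_trunc_le.
  by move=> x; exact: cvg_trunc.
apply: cvg_trans H; apply: near_eq_cvg; apply: nearW => K.
rewrite /trunc (@Rintegral_sum _ _ _ mu _ _ (fun=> 1)); last first.
  by move=> y x; case: (_ == _); rewrite ?normr0 ?normr1.
apply: eq_bigr => y _; congr (_ * _); rewrite -Rintegral_indic.
apply: eq_Rintegral => x _; congr ((nat_of_bool _)%:R).
apply/eqP/idP; rewrite inE/=; first by move=> <-; rewrite shiftK.
by move=> ->; rewrite shiftNK.
Qed.

Lemma cvg_sum_mass (M : R) f : (forall y, `|f y| <= M) ->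
  \sum_(y <- first_elts K) f y * p y @[K --> \oo] --> \int[mu]_x f x.
Proof.
have shift0 : @shift d n 0 = id.
  by apply/funext => x; apply/ffunP => k; rewrite ffunE addr0.
by move=> /(cvg_sum_shift (v := 0)); rewrite oppr0 shift0.
Qed.

(** A job leaving the system from [i] has rate [psi R x i * q]; all other contributions are
    nonnegative because the target differs from [x]. *)
Lemma rate_remove_gt0 x i : (0 < x i)%N ->
  0 < rate_matrix q lambda x (remove_job x i).
Proof.
move=> xi; set y := remove_job x i.
have xy : (x == y) = false.
  apply/eqP => /ffunP/(_ i); rewrite ffunE eqxx subn1 => xE.
  by move: xi; rewrite xE; case: (x i) xE => [|m] //= /esym/n_Sn.
have psi0 := @psi_ge0 R d n x.
have r0 : 0 <= (1 - q) / (2 * d)%:R by rewrite divr_ge0// subr_ge0 ltW.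
have t0 z : 0 <= (z == y)%:R - (x == y)%:R :> R by rewrite xy subr0.
rewrite /rate_matrix /generator (bigD1 i)//= ltr_wpDr//.
  apply: sumr_ge0 => j _; apply: addr_ge0; first apply: addr_ge0.
  - by apply: mulr_ge0 => //; apply: mulr_ge0 => //; exact: ltW.
  - by apply: mulr_ge0 => //; apply: mulr_ge0 => //; exact: ltW.
  - by apply: sumr_ge0 => k _; apply: mulr_ge0 => //; exact: mulr_ge0.
rewrite ltr_wpDr//.
  by apply: sumr_ge0 => k _; apply: mulr_ge0 => //; exact: mulr_ge0.
rewrite ltr_wpDl//.
  by apply: mulr_ge0 => //; apply: mulr_ge0 => //; exact: ltW.
by rewrite -/y eqxx xy subr0 mulr1 mulr_gt0// psi_gt0.
Qed.

(* The states to which mu gives more mass than its shift form a set which is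
   closed under the transitions.  Hence, unless it is empty, it contains
   the empty configuration; but this one is fixed by the shift. *)
Lemma mass_le_shift v x : p x <= p (shift v x).
Proof.
pose A := [pred y | p (shift v y) < p y].
pose F := G (fun y => (A y)%:R).
have A1 y : `|(A y)%:R| <= 1 :> R by case: (A y); rewrite ?normr0 ?normr1.
have F1 y : `|F y| <= C * (2 * 1) by exact: norm_generator_le.
have F_le0 y : A y -> F y <= 0.
  move=> Ay; rewrite -(@generator_cst R d n q lambda 0 y); apply: generator_le => // z.
  by rewrite Ay subrr; case: (A z); rewrite ?subrr// sub0r oppr_le0.
have F_ge0 y : ~~ A y -> 0 <= F y.
  move=> /negPf Ay; rewrite -(@generator_cst R d n q lambda 0 y).
  by apply: generator_le => // z; rewrite Ay subrr subr0.
have term_le0 y : F y * (p y - p (shift v y)) <= 0.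
  have [Ay|nAy] := boolP (A y).
    by rewrite mulr_le0_ge0 ?F_le0// subr_ge0 ltW.
  by rewrite mulr_ge0_le0 ?F_ge0// subr_le0 leNgt.
(* [F] has mean zero under [mu] and, since the generator commutes with shifts, under the translate
   of [mu]. *)
have lim0 : \sum_(y <- first_elts K) F y * (p y - p (shift v y)) @[K --> \oo] --> 0.
  have := cvgB (cvg_sum_mass F1) (cvg_sum_shift (v := - v) F1).
  rewrite opprK (Rintegral_generator A1).
  rewrite -(@eq_Rintegral _ _ _ mu setT _ (G ((fun y => (A y)%:R) \o shift (- v)))); last first.
    by move=> y _; rewrite generator_shift.
  rewrite (@Rintegral_generator 1) ?subr0; last by move=> y; exact: A1.
  move=> H; apply: cvg_trans (H _); apply: near_eq_cvg; apply: nearW => K.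
  by under [RHS]eq_bigr do rewrite mulrBr; rewrite sumrB.
(* Nonpositive terms with total zero all vanish, and on [A] the second factor is positive. *)
have F0 y : A y -> F y = 0.
  move=> Ay; have r0 : 0 < p y - p (shift v y) by rewrite subr_gt0.
  apply/eqP; rewrite eq_le F_le0//= -(pmulr_lge0 _ r0).
  rewrite -(cvg_lim _ lim0)//; apply: limr_le; first exact: cvgP lim0.
  exists (pickle y).+1 => // K /= yK.
  rewrite (bigD1_seq y) ?first_elts_uniq ?mem_first_elts//= gerDl.
  by apply: sumr_le0 => z _.
(* A transition out of [A] would make [F y] at most minus its positive rate. *)
have A_remove y i : A y -> (0 < y i)%N -> A (remove_job y i).
  move=> Ay yi; apply: contraT => nA; have := rate_remove_gt0 yi.
  rewrite -oppr_lt0 ltNge -(F0 _ Ay) => /negP[].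
  rewrite -mulN1r -[leRHS]addr0 -(@generator_cst R d n q lambda 0 y).
  rewrite -generator_linear; apply: generator_le => // z.
  rewrite Ay !addr0 !mulN1r opprK.
  case: eqVneq => [->|_]; first by rewrite (negPf nA) sub0r addrC lerDr.
  by case: (A z); case: (y == _) => /=; lra.
(* Induction on the number of jobs, removing them one at a time. *)
have A0 m y : (\sum_i y i <= m)%N -> A y -> A [ffun=> 0%N].
  elim: m y => [|m IH] y ym Ay.
    suff <- : y = [ffun=> 0%N] by [].
    apply/ffunP => i; rewrite ffunE; apply/eqP; rewrite -leqn0 (leq_trans _ ym)//.
    by rewrite (bigD1 i)//= leq_addr.
  have [i yi|y0] := pickP (fun i => 0 < y i)%N; last first.
    by apply: (IH y) => //; rewrite big1// => i _; apply/eqP; rewrite -leqn0 leqNgt y0.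
  apply: (IH (remove_job y i)); last exact: A_remove.
  rewrite -ltnS (leq_trans _ ym)// [leqRHS](bigD1 i)//= (bigD1 i)//= !ffunE eqxx.
  rewrite -addSn subn1 prednK// leq_add2l; apply: leq_sum => j _.
  by rewrite ffunE leq_subr.
rewrite leNgt; apply/negP => Ax; have := A0 _ _ (leqnn _) Ax.
rewrite /A /= (_ : shift v _ = [ffun=> 0%N]) ?ltxx//.
by apply/ffunP => k; rewrite !ffunE.
Qed.

Lemma mass_shift v x : p (shift v x) = p x.
Proof.
apply/eqP; rewrite eq_le mass_le_shift andbT.
by rewrite -[in leRHS](shiftK v x) mass_le_shift.
Qed.

Lemma Rintegral_shift (M : R) f v : (forall y, `|f y| <= M) ->
  \int[mu]_x f (shift v x) = \int[mu]_x f x.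
Proof.
move=> fM; have := cvg_sum_shift (v := v) fM.
under eq_fun do under eq_bigr do rewrite mass_shift.
by move=> /(cvg_unique _)/(_ (cvg_sum_mass fM)); apply.
Qed.

End invariant_mean.

(** * Moment bound for truncated queues *)

Section moment_bound.
Context {R : realType} {d n : nat} {q lambda : R}.
Implicit Types (x y : state d n) (i j v : torus d n).
Hypotheses (d_gt0 : (1 <= d)%N).
Hypotheses (q_gt0 : 0 < q) (q_lt1 : q < 1) (lambda_ge0 : 0 <= lambda).
Hypothesis hlambda : lambda < (2 * d + 1)%:R^-1.
Variable mu : probability (state d n) R.
Hypothesis mu_balance : forall y, \int[mu]_x rate_matrix q lambda x y = 0.

Local Notation W := (@lyap R d n q).
Local Notation X := (fun x : state d n => \sum_i (x i)%:R : R).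

(** The linear coefficient [(2 - q) / q] is at least 1. Thus queues are bounded where [W] is. *)
Lemma jobs_le_lyap x : X x <= W x.
Proof.
rewrite /lyap /sep; apply: ler_sum => i _.
rewrite ler_wpDl ?sqr_ge0// ler_peMl// ler_pdivlMr// mul1r lerBrDr.
exact: lerD (ltW q_lt1) (ltW q_lt1).
Qed.

Lemma lyap_ge0 x : 0 <= W x.
Proof. by rewrite (le_trans _ (jobs_le_lyap x))// sumr_ge0. Qed.

Lemma lyap_shift v x : W (shift v x) = W x.
Proof.
rewrite /lyap /sep [RHS](reindex_inj (addIr v)).
by apply: eq_bigr => i _; rewrite ffunE.
Qed.

(** The cut-off is on [W]: this event is translation invariant and is where [min(W, K)] inherits the
    drift bound of [W]. *)
Definition capped_queue (K : R) i x : R := (W x < K)%R%:R * (x i)%:R.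

Lemma capped_queue_ge0 K i x : 0 <= capped_queue K i x.
Proof. by rewrite mulr_ge0. Qed.

Lemma norm_capped_queue_le K i x : 0 <= K -> `|capped_queue K i x| <= K.
Proof.
move=> K0; rewrite ger0_norm ?capped_queue_ge0// /capped_queue.
case: ltP => [WK|_]; last by rewrite mul0r.
rewrite mul1r (le_trans _ (ltW WK))// (le_trans _ (jobs_le_lyap x))//.
by rewrite (bigD1 i)//= lerDl sumr_ge0.
Qed.

Lemma Rintegral_capped_queue_shift K i : 0 <= K ->
  \int[mu]_x capped_queue K i x = \int[mu]_x capped_queue K 0 x.
Proof.
move=> K0.
have := Rintegral_shift q_gt0 q_lt1 lambda_ge0 mu_balance i
  (fun x => norm_capped_queue_le 0 x K0).
move=> <-; apply: eq_Rintegral => x _.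
by rewrite /capped_queue lyap_shift ffunE add0r.
Qed.

(* Foster's criterion for min(lyap, K), which is bounded. *)
Lemma Rintegral_capped_queue_le K : 0 <= K ->
  \int[mu]_x capped_queue K 0 x
    <= lambda / (q * ((2 * d + 1)%:R^-1 - lambda)).
Proof.
move=> K0; set N : R := #|{: torus d n}|%:R.
set e := \int[mu]_x _; set delta := (2 * d + 1)%:R^-1 - lambda.
have delta0 : 0 < delta by rewrite subr_gt0.
have N0 : 0 < N by rewrite ltr0n; apply/card_gt0P; exists 0.
pose b := 2 * lambda * N; pose c := 2 * q * delta.
have b0 : 0 <= b by rewrite !mulr_ge0// ltW.
have c0 : 0 < c by rewrite !mulr_gt0.
pose f x := Num.min (W x) K.
have fK x : `|f x| <= K.
  by rewrite ger0_norm ?le_min ?lyap_ge0// ge_min lexx orbT.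
pose g x := b - c * \sum_i capped_queue K i x.
(* Below level [K], the increments of [f] are at most those of [W]; from [K] on, [f] is at its
   maximum and its drift is nonpositive. *)
have Gf x : generator q lambda f x <= g x.
  have [WK|KW] := ltP (W x) K.
    apply: (@le_trans _ _ (generator q lambda W x)).
      apply: generator_le => // y; rewrite {2}/f (min_idPl (ltW WK)) lerD2r.
      by rewrite ge_min lexx.
    rewrite (le_trans (generator_lyap_le _ _ _ _))// /g /capped_queue WK.
    by under [in leRHS]eq_bigr do rewrite mul1r.
  rewrite /g big1 ?mulr0 ?subr0; last first.
    by move=> i _; rewrite /capped_queue ltNge KW mul0r.
  apply: le_trans b0; rewrite -(@generator_cst R d n q lambda 0 x).
  apply: generator_le => // y.
  by rewrite subrr {2}/f (min_idPr KW) subr_le0 ge_min lexx orbT.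
have cq_le x : `|\sum_i capped_queue K i x| <= \sum_(i : torus d n) K.
  rewrite (le_trans (ler_norm_sum _ _ _))//.
  by apply: ler_sum => i _; exact: norm_capped_queue_le.
have cqi := integrable_bounded mu cq_le.
have ccqi : mu.-integrable setT (EFin \o (fun x => c * \sum_i capped_queue K i x)).
  apply: (@integrable_bounded _ _ _ mu (c * \sum_(i : torus d n) K)) => x.
  by rewrite normrM (gtr0_norm c0) ler_pM2l.
have bi : mu.-integrable setT (EFin \o (cst b)).
  by apply: (@integrable_bounded _ _ _ mu `|b|).
have gE : \int[mu]_x g x = b - c * \int[mu]_x \sum_i capped_queue K i x.
  rewrite RintegralB// RintegralZl// Rintegral_cst//.
  have -> : fine (mu setT) = 1 by have := probability_setT mu => ->.
  by rewrite mulr1.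
(* All nodes have the same mean by translation invariance, so the factor [N] cancels in the end. *)
have cq_int : \int[mu]_x (\sum_i capped_queue K i x) = N * e.
  under eq_Rintegral do (under eq_bigr do rewrite -[capped_queue _ _ _]mul1r).
  rewrite (@Rintegral_sum _ _ _ mu _ _ (fun=> K)); last first.
    by move=> i x; exact: norm_capped_queue_le.
  under eq_bigr do rewrite mul1r Rintegral_capped_queue_shift//.
  by rewrite sumr_const mulr_natl.
have : \int[mu]_x generator q lambda f x <= \int[mu]_x g x.
  apply: le_Rintegral => //.
  - apply: (@integrable_bounded _ _ _ mu (@rate_bound R d n q lambda * (2 * K))) => x.
    exact: norm_generator_le fK.
  - apply: (@integrable_bounded _ _ _ mu (`|b| + c * \sum_(i : torus d n) K)) => x.
    by rewrite (le_trans (ler_normB _ _))// lerD2l normrM (gtr0_norm c0) ler_pM2l.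
rewrite (Rintegral_generator q_gt0 q_lt1 lambda_ge0 mu_balance fK) gE cq_int.
rewrite subr_ge0 /b /c => H.
rewrite ler_pdivlMr ?mulr_gt0// -(ler_pM2r N0) -(ler_pM2l (ltr0n _ 2)).
by lra.
Qed.

End moment_bound.

(** * Removal of the truncation *)

Theorem theorem15 (R : realType) (d n : nat) (q lambda : R)
    (P : R -> R.-pker (state d n) ~> (state d n))
    (mu : probability (state d n) R)
    (hd : (1 <= d)%N) (hn : (2 <= n)%N)
    (hq0 : 0 < q) (hq1 : q < 1)
    (hlambda0 : 0 <= lambda) (hlambda : lambda < (2 * d + 1)%:R^-1)
    (hP : is_transition_function (rate_matrix q lambda) P)
    (hmu : is_stationary P mu) :
  ('E_mu[fun x : state d n => (x 0%R)%:R]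
     <= (lambda / (q * ((2 * d + 1)%:R^-1 - lambda)))%:E)%E.
Proof.
have mu_balance := balance hq0 hq1 hlambda0 hP hmu.
rewrite unlock.
pose u k (x : state d n) : \bar R := (capped_queue (q := q) k%:R 0 x)%:E.
(* The sequence is constant once [k] exceeds the Lyapunov value of [x]. *)
have u_cvg x : u k x @[k --> \oo] --> (x 0%R)%:R%:E.
  apply: cvg_near_cst; near=> k; apply/eqP; rewrite /u /capped_queue.
  rewrite (_ : (_ < _)%R) ?mul1r//; near: k; exact: nbhs_infty_gtr.
(* Monotone convergence in the extended reals presupposes no finite mean. *)
have u_int : (\int[mu]_x u k x)%E @[k --> \oo] --> (\int[mu]_x (x 0%R)%:R%:E)%E.
  rewrite (eq_integral (fun x => limn (u^~ x))); last first.
    by move=> x _; rewrite (cvg_lim _ (u_cvg x)).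
  apply: cvg_monotone_convergence => //.
    by move=> k x _; rewrite lee_fin capped_queue_ge0.
  move=> x _ k l kl; rewrite lee_fin ler_wpM2r//.
  by case: ltP => // xk; rewrite (lt_le_trans xk)// ler_nat.
rewrite -(cvg_lim _ u_int)//; apply: lime_le; first exact: cvgP u_int.
apply: nearW => k; rewrite -[leLHS]fineK; last first.
  apply: integrable_fin_num => //.
  apply: (@integrable_bounded _ _ _ mu k%:R) => x.
  exact: norm_capped_queue_le.
by rewrite lee_fin; exact: Rintegral_capped_queue_le.
Unshelve. all: by end_near.
Qed.
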